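(* Let $V$ be an infinite-dimensional vector space over a field $\mathbb{F}$ and let $u$ be an endomorphism of $V$ with no dominant eigenvalue. Then, for every scalar $a\in\mathbb{F}$, the endomorphism $u$ is $a$-elementarily decomposable, i.e. there exists an endomorphism $v$ of $V$ such that $v^2=av$ and $u-v$ is elementary.
   Context: A scalar $\lambda$ is a dominant eigenvalue of $u\in\mathrm{End}(V)$ if $\operatorname{rk}(u-\lambda\,\mathrm{id}_V)<\dim V$. For $u\in\mathrm{End}(V)$, $V^u$ denotes the $\mathbb{F}[t]$-module with underlying space $V$ and $t\cdot x:=u(x)$. The endomorphism $u$ is called elementary if $V^u$ is a free $\mathbb{F}[t]$-module. *)

(* Defs.v *)
From HB Require Import structures.
From mathcomp Require Import all_boot all_order all_algebra.
From mathcomp Require Import boolp classical_sets cardinality.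
Set Implicit Arguments. Unset Strict Implicit. Unset Printing Implicit Defensive.
Import Order.TTheory GRing.Theory Num.Theory.
Local Open Scope ring_scope.
Local Open Scope classical_set_scope.

Section Defs.
Variables (F : fieldType) (V : lmodType F).

Definition in_span (S : set V) (x : V) : Prop :=
  exists n (b : 'I_n -> V) (c : 'I_n -> F),
    (forall i, S (b i)) /\ x = \sum_(i < n) c i *: b i.

Definition lin_indep (S : set V) : Prop :=
  forall n (b : 'I_n -> V) (c : 'I_n -> F),
    injective b -> (forall i, S (b i)) ->
    \sum_(i < n) c i *: b i = 0 -> forall i, c i = 0.

Definition is_basis_of (W S : set V) : Prop :=
  S `<=` W /\ lin_indep S /\ (forall x, W x <-> in_span S x).

Definition infinite_dim : Prop :=
  ~ exists n (b : 'I_n -> V), forall x : V,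
      exists c : 'I_n -> F, x = \sum_(i < n) c i *: b i.

Definition rank_lt_dim (f : V -> V) : Prop :=
  exists B C : set V, is_basis_of (range f) B /\ is_basis_of setT C /\
    ((B #<= C)%card /\ ~ (C #<= B)%card).

Definition dominant_eigenvalue (u : V -> V) (lambda : F) : Prop :=
  rank_lt_dim (fun x => u x - lambda *: x).

Definition poly_act (f : V -> V) (p : {poly F}) (x : V) : V :=
  \sum_(k < size p) p`_k *: iter k f x.

(* f is elementary: V^f is a free F[t]-module (has an F[t]-basis) *)
Definition elementary (f : V -> V) : Prop :=
  exists B : set V,
    (forall x, exists n (b : 'I_n -> V) (p : 'I_n -> {poly F}),
        (forall i, B (b i)) /\ x = \sum_(i < n) poly_act f (p i) (b i)) /\
    (forall n (b : 'I_n -> V) (p : 'I_n -> {poly F}),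
        injective b -> (forall i, B (b i)) ->
        \sum_(i < n) poly_act f (p i) (b i) = 0 -> forall i, p i = 0).

End Defs.

(* Main.v *)
(* Take [Y] maximal such that the vectors [y] and [u y], for [y] in [Y], form a
   free family, and let [W] be their span.  By maximality [u] acts as a scalar
   [l] modulo [W] (or [W] has codimension at most 1).  Hence the range of
   [u - l] lies in [W], and since [l] is not dominant, [Y] has the cardinality
   of a basis [S] of [V] containing [Y] and [u Y]; so [S * nat] embeds in [Y],
   by some [g].
   Give [g (b, n)] rank [n], and [u y] a rank one more than [y].  Set
   [v y = a y] for [y] in [Y] and [v b = - g (b, n_b)] for [b] in [S \ Y], with
   [n_b] larger than the ranks of [b] and of the basis vectors occurring in
   [u b].  Then [v^2 = a v], and up to terms of lower rank [u - v] sends [y] to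
   [u y] and [b] to [g (b, n_b)]: it acts as an injective, rank-increasing shift
   of the basis [S], so the vectors outside the image of the shift form an
   [F[t]]-basis. *)
Require Import Defs.
From HB Require Import structures.
From mathcomp Require Import all_boot all_order all_algebra.
From mathcomp Require Import boolp classical_sets functions cardinality.
From mathcomp Require Import zify.
Set Implicit Arguments. Unset Strict Implicit. Unset Printing Implicit Defensive.
Import GRing.Theory.
Local Open Scope classical_set_scope.
Local Open Scope card_scope.

(** * Cardinal comparison and maximal sets *)

Lemma inj_card_leP (T U : Type) (u0 : U) (A : set T) (B : set U) :
  (A #<= B) <-> exists f : T -> U, (forall x, A x -> B (f x)) /\
    (forall x y, A x -> A y -> f x = f y -> x = y).
Proof.
split; last first.
  move=> [f [fAB finj]].
  have /injfunPex[g] : exists2 f : T -> U, set_fun A B f & set_inj A f.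
    by exists f => // x y; rewrite !inE => Ax Ay /finj; apply.
  exact: inj_card_le.
elim/Ppointed: U => U in u0 B *; first by case: (no u0).
move=> /pcard_leP/injfunPex[f fAB finj]; exists f; split=> // x y Ax Ay.
by apply: finj; rewrite inE.
Qed.

(* A maximal disjoint family [E] of injective sequences covers [A] up to a finite
   set, so [A] embeds in [E * nat], and [E * nat * nat] embeds back in [A]. *)
Lemma card_le_mul_nat (T : Type) (A : set T) :
  infinite_set A -> A `*` [set: nat] #<= A.
Proof.
move=> Ainf; have [x0 Ax0] := infinite_setN0 Ainf.
pose D := [set f : nat -> T | injective f /\ range f `<=` A].
have [E [ED tE maxE]] := ex_maximal_disjoint_subcollection (fun f => range f) D.
pose R := A `\` \bigcup_(f in E) range f.
(* An infinite remainder would contain an injective sequence disjoint from every member of [E],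
   against maximality. *)
have Rfin : finite_set R.
  apply: contrapT => /infiniteP/(inj_card_leP x0)[f [fR finj]].
  have fD : D f.
    split=> [m n|_ [n _ <-]]; first exact: finj.
    by have [] := fR n I.
  have fNE g x : E g -> range g x -> range f x -> False.
    by move=> Eg gx [n _ fnx]; have [_ []] := fR n I; exists g; rewrite ?fnx.
  apply: (maxE (E `|` [set f])).
  - split; first by move=> g; left.
    move=> /(_ f (or_intror erefl)) Ef.
    by apply: (fNE f (f 0%N)) => //; exists 0%N.
  - by move=> g [/ED//|->].
  - move=> g h [Eg|->] [Eh|->] [x [gx hx]] //.
    + by apply: tE => //; exists x.
    + by case: (fNE g x).
    + by case: (fNE h x).
have [f0 Ef0] : E !=set0.
  apply/set0P/eqP => E0; apply: Ainf.
  by move: Rfin; rewrite /R E0 bigcup_set0 setD0.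
(* One sequence [f0] of [E] absorbs the remainder: the elements of [R] and of [range f0] are
   renumbered together by [phi] and all assigned to [f0]. *)
have cK : countable (range f0 `|` R).
  rewrite -bigcup2E; apply: bigcup_countable => // -[|[|n]] _ //=.
    exact: (sub_countable (card_image_le _ _)).
  exact: finite_set_countable.
have /countable_injP[phi phi_inj] := cK.
pose P x (p : (nat -> T) * nat) := A x -> E p.1 /\
  ((p.1 p.2 = x /\ p.1 <> f0) \/
   (p.1 = f0 /\ p.2 = phi x /\ (range f0 `|` R) x)).
have /choice[h hP] : forall x, exists p, P x p.
  move=> x; have [Ax|] := pselect (A x); last by exists (f0, 0%N).
  have [Kx|NKx] := pselect ((range f0 `|` R) x).
    by exists (f0, phi x) => _; split => //; right.
  have [f Ef [n _ fnx]] : (\bigcup_(f in E) range f) x.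
    by apply: contrapT => Nx; apply: NKx; right.
  exists (f, n) => _; split => //; left; split=> //= ff0.
  by apply: NKx; left; exists n; rewrite -?ff0.
apply/(inj_card_leP x0).
(* If [x] is assigned place [k] in the sequence [f], then [(x, m)] goes to the entry of [f] at the
   code of [(k, m)]. *)
exists (fun q => (h q.1).1 (pickle ((h q.1).2, q.2))); split=> [[x m] [/= Ax _]|].
  by have [/ED[_ + _]] := hP x Ax; apply; exists (pickle ((h x).2, m)).
move=> [x m] [y n] [/= Ax _] [/= Ay _] exy.
have [Ex hx] := hP x Ax; have [Ey hy] := hP y Ay.
have exyh : (h x).1 = (h y).1.
  apply: tE => //; exists ((h x).1 (pickle ((h x).2, m))).
  by split; [|rewrite exy]; exact: imageT.
move: exy; rewrite exyh => /((ED _ Ey).1)/(pcan_inj (@pickleK _))[e2 <-].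
congr pair; case: hx hy => [[ex nx]|[ex [px Kx]]] [[ey ny]|[ey [py Ky]]].
- by rewrite -ex -ey exyh e2.
- by case: nx; rewrite exyh.
- by case: ny; rewrite -exyh.
- by apply: phi_inj; rewrite ?inE// -px -py.
Qed.

Lemma card_le_mul_nat_trans (T U : Type) (A : set T) (B : set U) :
  infinite_set B -> A #<= B `*` [set: nat] -> A `*` [set: nat] #<= B.
Proof.
move=> Binf AB; have [b0 Bb0] := infinite_setN0 Binf.
have BB := card_le_mul_nat Binf.
apply: (card_le_trans _ BB); move: (card_le_trans AB BB).
move=> /(inj_card_leP b0)[f [fB finj]]; apply/(inj_card_leP (b0, 0%N)).
exists (fun p => (f p.1, p.2)); split=> [[x n] [/= /fB]//|].
by move=> [x n] [y m] [/= Ax _] [/= Ay _] [/finj -> // ->].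
Qed.

(** Zorn's lemma for a condition of finite character: a list drawn from the union of a nonempty
    chain already lies in one member. *)
Lemma finitary_maximal (T : eqType) (Q : seq T -> Prop) (A W : set T) :
  A `<=` W -> (forall s : seq T, [set` s] `<=` A -> Q s) ->
  exists M : set T, [/\ A `<=` M, M `<=` W,
    (forall s : seq T, [set` s] `<=` M -> Q s) &
    forall x, W x -> ~ M x ->
      exists s : seq T, [set` s] `<=` M `|` [set x] /\ ~ Q s].
Proof.
move=> AW QA.
(* The order is on the part [B] added to [A], so that the empty union, coming from the empty chain,
   satisfies [P] as well. *)
pose P (B : set T) := B `<=` W /\ forall s : seq T, [set` s] `<=` A `|` B -> Q s.
have [F FP Ftot|M [[MW QM] Mmax]] := @Zorn_bigcup T P.
  split=> [x [B FB Bx]|s sA]; first exact: (FP _ FB).1.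
  have [sA'|[B FB sB]] : [set` s] `<=` A \/
      exists2 B, F B & [set` s] `<=` A `|` B.
    elim: s sA => [|x s IHs] sA; first by left.
    have [|sA'|[B FB sB]] := IHs.
    - by move=> y ys; apply: sA; rewrite /= inE ys orbT.
    - have [Ax|[B FB Bx]] := sA x (mem_head _ _).
        by left=> y; rewrite /= inE => /predU1P[->//|]; exact: sA'.
      right; exists B => // y; rewrite /= inE => /predU1P[->|]; first by right.
      by move=> /sA' Ay; left.
    - right; have [Ax|[C FC Cx]] := sA x (mem_head _ _).
        exists B => // y; rewrite /= inE => /predU1P[->|]; first by left.
        exact: sB.
      have [BC|CB] := Ftot _ _ FB FC.
        exists C => // y; rewrite /= inE => /predU1P[->|]; first by right.
        by move=> /sB[|/BC]; [left|right].
      exists B => // y; rewrite /= inE => /predU1P[->|]; last exact: sB.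
      by right; apply: CB.
  - exact: QA.
  - exact: (FP _ FB).2.
exists (A `|` M); split=> //.
- by move=> x [/AW|/MW].
move=> x Wx NMx.
have : ~ P (M `|` [set x]).
  apply: Mmax; split; first by move=> y; left.
  by move=> /(_ x (or_intror erefl)) Mx; apply: NMx; right.
move=> NP; apply: contrapT => NQ; apply: NP; split.
  by move=> y [/MW//|->].
move=> s sAM; apply: contrapT => NQs; apply: NQ; exists s; split => // y /sAM.
by rewrite setUA.
Qed.

Local Open Scope ring_scope.

(** * Spans, bases and linear maps in arbitrary dimension *)

Section LinearAlgebra.
Variables (F : fieldType) (V : lmodType F).

Definition subspace (P : V -> Prop) : Prop :=
  P 0 /\ forall a x y, P x -> P y -> P (a *: x + y).

Lemma subspaceD P x y : subspace P -> P x -> P y -> P (x + y).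
Proof. by move=> [_ P2] Px Py; rewrite -[x]scale1r; exact: P2. Qed.

Lemma subspaceZ P a x : subspace P -> P x -> P (a *: x).
Proof. by move=> [P0 P2] Px; rewrite -[_ *: _]addr0; exact: P2. Qed.

Lemma subspaceB P x y : subspace P -> P x -> P y -> P (x - y).
Proof. by move=> [_ P2] Px Py; rewrite addrC -scaleN1r; exact: P2. Qed.

Lemma subspace_sum P (I : Type) (r : seq I) (f : I -> V) :
  subspace P -> (forall i, P (f i)) -> P (\sum_(i <- r) f i).
Proof.
by move=> sP Pf; elim/big_rec: _ => [|i x _]; [exact: sP.1|exact: subspaceD].
Qed.

Lemma in_span_gen (S : set V) x : S x -> in_span S x.
Proof.
by move=> Sx; exists 1%N, (fun=> x), (fun=> 1); rewrite big_ord1 scale1r.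
Qed.

Lemma in_span_subspace (S : set V) : subspace (in_span S).
Proof.
split; first by exists 0%N, (fun=> 0), (fun=> 0); split=> [[]//|]; rewrite big_ord0.
move=> a x y [m [b [c [Sb ->]]]] [n [b' [c' [Sb' ->]]]].
exists (m + n)%N.
exists (fun i : 'I_(m + n) =>
  match fintype.split i with inl j => b j | inr j => b' j end).
exists (fun i : 'I_(m + n) =>
  match fintype.split i with inl j => a * c j | inr j => c' j end).
split=> [i|]; first by case: (fintype.split i).
rewrite big_split_ord scaler_sumr /=; congr (_ + _); apply: eq_bigr => i _.
  by rewrite (unsplitK (inl i)) scalerA.
by rewrite (unsplitK (inr i)).
Qed.

Lemma in_span_min (S : set V) (P : V -> Prop) x :
  subspace P -> (forall y, S y -> P y) -> in_span S x -> P x.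
Proof.
move=> sP SP [n [b [c [Sb ->]]]]; apply: subspace_sum => // i.
by apply: subspaceZ => //; exact: SP.
Qed.

Lemma in_span_sub (S T : set V) x : S `<=` T -> in_span S x -> in_span T x.
Proof.
move=> ST; apply: in_span_min; first exact: in_span_subspace.
by move=> y /ST; exact: in_span_gen.
Qed.

(** Serves to rewrite combinations with different supports over the common list [undup (s ++ t)]. *)
Lemma big_subseq_support (W : nmodType) (s t : seq V) (f : V -> W) :
  uniq s -> uniq t -> {subset s <= t} -> (forall b, b \notin s -> f b = 0) ->
  \sum_(b <- t) f b = \sum_(b <- s) f b.
Proof.
move=> us ut st f0; rewrite (bigID (mem s)) /= [X in _ + X]big1 // addr0.
rewrite -big_filter; apply/perm_big/uniq_perm; rewrite ?filter_uniq//.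
by move=> b; rewrite mem_filter andb_idr//; exact: st.
Qed.

(** Replaces an indexed family, possibly with repetitions, by a finitely supported coefficient
    function on [V]; the vectors with such an expansion form a subspace containing [S]. *)
Lemma in_span_seq (S : set V) x : in_span S x ->
  exists (s : seq V) (c : V -> F), [/\ uniq s, [set` s] `<=` S,
    (forall b, b \notin s -> c b = 0) & x = \sum_(b <- s) c b *: b].
Proof.
pose P x := exists (s : seq V) (c : V -> F), [/\ uniq s, [set` s] `<=` S,
  (forall b, b \notin s -> c b = 0) & x = \sum_(b <- s) c b *: b].
apply: (@in_span_min S P); last first.
  move=> y Sy; exists [:: y], (fun b => (b == y)%:R); split=> //.
  - by move=> b; rewrite /= inE => /eqP->.
  - by move=> b; rewrite inE => /negPf->.
  - by rewrite big_seq1 eqxx scale1r.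
split; first by exists [::], (fun=> 0); split=> //; rewrite big_nil.
move=> a y z [s [c [us sS c0 ->]]] [t [d [ut tS d0 ->]]].
exists (undup (s ++ t)), (fun b => a * c b + d b); split.
- exact: undup_uniq.
- by move=> b; rewrite /= mem_undup mem_cat => /orP[/sS|/tS].
- move=> b; rewrite mem_undup mem_cat negb_or => /andP[/c0-> /d0->].
  by rewrite mulr0 addr0.
- rewrite -(@big_subseq_support _ s (undup (s ++ t))) ?undup_uniq//; first last.
  + by move=> b /c0->; rewrite scale0r.
  + by move=> b bs; rewrite mem_undup mem_cat bs.
  rewrite -(@big_subseq_support _ t (undup (s ++ t))) ?undup_uniq//; first last.
  + by move=> b /d0->; rewrite scale0r.
  + by move=> b bs; rewrite mem_undup mem_cat bs orbT.
  rewrite scaler_sumr -big_split; apply: eq_bigr => b _ /=.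
  by rewrite scalerDl scalerA.
Qed.

Lemma in_span_sum_seq (S : set V) (s : seq V) (c : V -> F) :
  [set` s] `<=` S -> in_span S (\sum_(b <- s) c b *: b).
Proof.
move=> sS; rewrite big_seq; elim/big_rec: _ => [|b x bs].
  exact: (in_span_subspace S).1.
by apply: (in_span_subspace S).2; apply/in_span_gen/sS.
Qed.

(** Vacuous on lists with repetitions, so that it can be required of every list drawn from a set, as
    in [finitary_maximal]. *)
Definition free_seq (s : seq V) : Prop := uniq s -> forall c : V -> F,
  \sum_(b <- s) c b *: b = 0 -> forall b, b \in s -> c b = 0.

Lemma lin_indep_seqP (S : set V) :
  lin_indep S <-> forall s : seq V, [set` s] `<=` S -> free_seq s.
Proof.
split=> [iS s sS us c c0 b bs|fS n b c b_inj Sb c0 i].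
  have /(tnthP (in_tuple s))[i ->] : b \in in_tuple s by [].
  apply: (iS (size s) (tnth (in_tuple s)) (fun i => c (tnth (in_tuple s) i))).
  - by apply/tuple_uniqP.
  - by move=> j; apply: sS; rewrite /= mem_tnth.
  - by rewrite -[RHS]c0 [RHS]big_tnth.
pose d x := if [pick j | b j == x] is Some j then c j else 0.
have db j : d (b j) = c j.
  rewrite /d; case: pickP => [k /eqP/b_inj->//|/(_ j)]; by rewrite eqxx.
rewrite -db; apply: (fS (codom b)).
- by move=> x /= /codomP[j ->].
- by rewrite map_inj_uniq ?enum_uniq.
- rewrite big_map big_enum -[RHS]c0; apply: eq_bigr => j _; by rewrite db.
- exact: codom_f.
Qed.

Lemma lin_indep_uniq_coef (S : set V) (s t : seq V) (c d : V -> F) :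
  lin_indep S -> uniq s -> uniq t -> [set` s] `<=` S -> [set` t] `<=` S ->
  (forall b, b \notin s -> c b = 0) -> (forall b, b \notin t -> d b = 0) ->
  \sum_(b <- s) c b *: b = \sum_(b <- t) d b *: b -> c =1 d.
Proof.
move=> /lin_indep_seqP iS us ut sS tS c0 d0 e b.
pose r := undup (s ++ t).
have rs : {subset s <= r} by move=> x xs; rewrite mem_undup mem_cat xs.
have rt : {subset t <= r} by move=> x xt; rewrite mem_undup mem_cat xt orbT.
have ur : uniq r by exact: undup_uniq.
have [br|br] := boolP (b \in r); last first.
  by rewrite c0 ?d0//; [apply: contra br => /rt|apply: contra br => /rs].
apply/eqP; rewrite -subr_eq0; apply/eqP.
apply: (iS r _ ur (fun x => c x - d x)) => //.
  by move=> x; rewrite /= mem_undup mem_cat => /orP[/sS|/tS].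
under eq_bigr do rewrite scalerBl.
rewrite sumrB (big_subseq_support us ur rs); last by move=> x /c0->; rewrite scale0r.
rewrite (big_subseq_support ut ur rt); last by move=> x /d0->; rewrite scale0r.
by rewrite e subrr.
Qed.

Lemma linear_extension (W : lmodType F) (S : set V) (f : V -> W) :
  is_basis_of setT S -> exists g : {linear V -> W}, forall b, S b -> g b = f b.
Proof.
move=> [_ [iS genS]].
have rep x : exists p : seq V * (V -> F), [/\ uniq p.1, [set` p.1] `<=` S,
    (forall b, b \notin p.1 -> p.2 b = 0) & x = \sum_(b <- p.1) p.2 b *: b].
  by have /in_span_seq[s [c ?]] := (genS x).1 I; exists (s, c).
have /choice[r rP] := rep.
pose g x := \sum_(b <- (r x).1) (r x).2 b *: f b.
(* Uniqueness of coefficients lets [g] be computed from any expansion, not only the chosen one;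
   linearity then follows by combining expansions. *)
have gE x s c : uniq s -> [set` s] `<=` S -> (forall b, b \notin s -> c b = 0) ->
    x = \sum_(b <- s) c b *: b -> g x = \sum_(b <- s) c b *: f b.
  move=> us sS c0 xE; have [ur rS r0 rE] := rP x.
  have cr : c =1 (r x).2.
    by apply: (lin_indep_uniq_coef iS us ur sS rS c0 r0); rewrite -xE -rE.
  have ut : uniq (undup (s ++ (r x).1)) by exact: undup_uniq.
  transitivity (\sum_(b <- undup (s ++ (r x).1)) (r x).2 b *: f b).
    rewrite (big_subseq_support ur ut)//.
    + by move=> b bs; rewrite mem_undup mem_cat bs orbT.
    + by move=> b /r0->; rewrite scale0r.
  under eq_bigr do rewrite -cr.
  rewrite (big_subseq_support us ut)//.
  - by move=> b bs; rewrite mem_undup mem_cat bs.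
  - by move=> b /c0->; rewrite scale0r.
have glin : linear g.
  move=> a x y; have [us sS c0 xE] := rP x; have [ut tS d0 yE] := rP y.
  set s := (r x).1 in us sS c0 xE; set c := (r x).2 in c0 xE.
  set t := (r y).1 in ut tS d0 yE; set d := (r y).2 in d0 yE.
  have uu : uniq (undup (s ++ t)) by exact: undup_uniq.
  have st : {subset s <= undup (s ++ t)}.
    by move=> b bs; rewrite mem_undup mem_cat bs.
  have tt : {subset t <= undup (s ++ t)}.
    by move=> b bs; rewrite mem_undup mem_cat bs orbT.
  rewrite (gE (a *: x + y) (undup (s ++ t)) (fun b => a * c b + d b)) //.
  - rewrite /g -/s -/t -/c -/d.
    rewrite -(big_subseq_support us uu st); last by move=> b /c0->; rewrite scale0r.
    rewrite -(big_subseq_support ut uu tt); last by move=> b /d0->; rewrite scale0r.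
    rewrite scaler_sumr -big_split; apply: eq_bigr => b _ /=.
    by rewrite scalerDl scalerA.
  - by move=> b; rewrite /= mem_undup mem_cat => /orP[/sS|/tS].
  - move=> b; rewrite mem_undup mem_cat negb_or => /andP[/c0-> /d0->].
    by rewrite mulr0 addr0.
  - rewrite {1}xE {1}yE.
    rewrite -(big_subseq_support us uu st); last by move=> b /c0->; rewrite scale0r.
    rewrite -(big_subseq_support ut uu tt); last by move=> b /d0->; rewrite scale0r.
    rewrite scaler_sumr -big_split; apply: eq_bigr => b _ /=.
    by rewrite scalerDl scalerA.
pose gM := GRing.isLinear.Build F V W *:%R g glin.
pose gL : {linear V -> W} := HB.pack g gM.
exists gL => b Sb; rewrite /= (gE b [:: b] (fun x => (x == b)%:R)) //.
- by rewrite big_seq1 eqxx scale1r.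
- by move=> x; rewrite /= inE => /eqP->.
- by move=> x; rewrite inE => /negPf->.
- by rewrite big_seq1 eqxx scale1r.
Qed.

(** Coordinate functionals, obtained by extending the indicator of each [b] linearly. *)
Lemma dual_family (S : set V) : is_basis_of setT S ->
  exists k : V -> {scalar V}, forall b b', S b -> S b' -> k b b' = (b == b')%:R.
Proof.
move=> bS.
have /choice[k kP] : forall b, exists l : {scalar V},
    forall b', S b' -> l b' = (b == b')%:R.
  by move=> b; exact: (@linear_extension F^o).
by exists k => b b' Sb; exact: kP.
Qed.

Lemma dual_span0 (S T : set V) (k : V -> {scalar V}) b x :
  (forall b b', S b -> S b' -> k b b' = (b == b')%:R) ->
  T `<=` S -> S b -> ~ T b -> in_span T x -> k b x = 0.
Proof.
move=> kP TS Sb NTb; apply: (@in_span_min T (fun x => k b x = 0)) => [|y Ty].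
  split; first exact: linear0.
  by move=> a y z; rewrite linearP => -> ->; rewrite mulr0 addr0.
by rewrite (kP _ _ Sb (TS _ Ty)); case: (eqVneq b y) => // eby; case: NTb; rewrite eby.
Qed.

(** A maximal free set between [S0] and [W] spans [W], since a vector of [W] outside its span could
    be adjoined. *)
Lemma lin_indep_extend (S0 W : set V) : subspace W -> S0 `<=` W -> lin_indep S0 ->
  exists S, S0 `<=` S /\ is_basis_of W S.
Proof.
move=> sW S0W /lin_indep_seqP iS0.
have [S [S0S SW iS Smax]] := finitary_maximal S0W iS0.
exists S; split=> //; split=> //; split; first exact/lin_indep_seqP.
move=> x; split; last by apply: in_span_min.
move=> Wx; have [Sx|NSx] := pselect (S x); first exact: in_span_gen.
have [s [sS NQ]] := Smax x Wx NSx.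
apply: contrapT => Nspan; apply: NQ => us c c0.
(* Otherwise the relation could be solved for [x], putting it in the span of [S]. *)
have xs0 : x \in s -> c x = 0.
  move=> xs; apply: contrapT => /eqP cx; apply: Nspan.
  move: c0; rewrite (bigD1_seq x) //= => /eqP; rewrite addrC addr_eq0 => /eqP e.
  have -> : x = (- (c x)^-1) *: \sum_(i <- s | i != x) c i *: i.
    by rewrite e scalerN scaleNr opprK scalerA mulVf ?scale1r.
  apply: subspaceZ; first exact: in_span_subspace.
  rewrite -big_filter; apply: in_span_sum_seq => b /=; rewrite mem_filter.
  by move=> /andP[/eqP bx /sS[]].
move=> b bs; have [ebx|bx] := eqVneq b x.
  by rewrite ebx; apply: xs0; rewrite -ebx.
apply: (iS [seq i <- s | i != x]); rewrite ?filter_uniq ?mem_filter ?bx//.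
  by move=> i /=; rewrite mem_filter => /andP[/eqP ix /sS[]].
rewrite big_filter -[RHS]c0 [RHS](bigID (fun i => i != x)) /=.
rewrite [X in _ = _ + X]big_seq_cond [X in _ = _ + X]big1 ?addr0// => i.
by rewrite negbK => /andP[is_ /eqP ix]; rewrite ix in is_ *; rewrite xs0 ?scale0r.
Qed.

End LinearAlgebra.

(** * A shift criterion for freeness over [F[t]] *)

Section ElementaryCriterion.
Variables (F : fieldType) (V : lmodType F) (w : {linear V -> V}).

(** A common length [N] lets the actions of polynomials of different sizes be added term by term. *)
Lemma poly_act_wide N (p : {poly F}) x : (size p <= N)%N ->
  poly_act w p x = \sum_(k < N) p`_k *: iter k w x.
Proof.
move=> pN; rewrite /poly_act (big_ord_widen N (fun k => p`_k *: iter k w x) pN).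
rewrite [RHS](bigID (fun k : 'I_N => (k < size p)%N)) /= [X in _ = _ + X]big1 ?addr0//.
by move=> k; rewrite -leqNgt => pk; rewrite nth_default ?scale0r.
Qed.

Lemma poly_actD a p q x :
  poly_act w (a *: p + q) x = a *: poly_act w p x + poly_act w q x.
Proof.
pose N := maxn (size (a *: p + q)) (maxn (size p) (size q)).
rewrite (@poly_act_wide N) ?leq_maxl// (@poly_act_wide N p); last first.
  by rewrite leq_max leq_maxl orbT.
rewrite (@poly_act_wide N q); last by rewrite !leq_max leqnn !orbT.
rewrite scaler_sumr -big_split; apply: eq_bigr => k _.
by rewrite coefD coefZ scalerDl scalerA.
Qed.

Lemma poly_act1 x : poly_act w 1 x = x.
Proof. by rewrite /poly_act size_poly1 big_ord1 coef1 scale1r. Qed.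

Lemma poly_act0 x : poly_act w 0 x = 0.
Proof. by rewrite /poly_act size_poly0 big_ord0. Qed.

Lemma poly_actX p x : poly_act w ('X * p) x = w (poly_act w p x).
Proof.
rewrite (@poly_act_wide (size p).+1); last first.
  by rewrite mulrC (leq_trans (size_polyMleq _ _))// size_polyX addn2.
rewrite big_ord_recl coefXM eqxx scale0r add0r linear_sum.
by apply: eq_bigr => k _; rewrite coefXM linearZ.
Qed.

Definition generated (B : set V) (x : V) : Prop :=
  exists n (b : 'I_n -> V) (p : 'I_n -> {poly F}),
    (forall i, B (b i)) /\ x = \sum_(i < n) poly_act w (p i) (b i).

Lemma generated_subspace B : subspace (generated B).
Proof.
split.
  by exists 0%N, (fun=> 0), (fun=> 0); split=> [[]//|]; rewrite big_ord0.
move=> a x y [m [b [p [Bb ->]]]] [n [b' [p' [Bb' ->]]]]; exists (m + n)%N.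
exists (fun i : 'I_(m + n) =>
  match fintype.split i with inl j => b j | inr j => b' j end).
exists (fun i : 'I_(m + n) =>
  match fintype.split i with inl j => a *: p j | inr j => p' j end).
split=> [i|]; first by case: (fintype.split i).
rewrite big_split_ord scaler_sumr /=; congr (_ + _); apply: eq_bigr => i _.
  by rewrite (unsplitK (inl i)) -[a *: p i]addr0 poly_actD poly_act0 addr0.
by rewrite (unsplitK (inr i)).
Qed.

Lemma generated_stable B x : generated B x -> generated B (w x).
Proof.
move=> [n [b [p [Bb ->]]]]; exists n, b, (fun i => 'X * p i); split=> //.
by rewrite linear_sum; apply: eq_bigr => i _; rewrite poly_actX.
Qed.

Lemma generated_gen B x : B x -> generated B x.
Proof.
move=> Bx; exists 1%N, (fun=> x), (fun=> 1); split=> //.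
by rewrite big_ord1 poly_act1.
Qed.

(* An [F[t]]-basis is given by the elements of [S] outside [sigma @` S]. *)
Lemma elementary_of_shift (S : set V) (sigma : V -> V) (rho : V -> nat) :
  is_basis_of setT S ->
  (forall b, S b -> S (sigma b)) ->
  (forall b b', S b -> S b' -> sigma b = sigma b' -> b = b') ->
  (forall b, S b -> (rho b < rho (sigma b))%N) ->
  (forall b, S b -> in_span [set b' | S b' /\ (rho b' < rho (sigma b))%N]
                      (w b - sigma b)) ->
  elementary w.
Proof.
move=> bS Ssigma sigma_inj rho_lt w_low.
have [_ [iS genS]] := bS; have [k kP] := dual_family bS.
pose B := [set b | S b /\ forall b', S b' -> sigma b' <> b].
have BS : B `<=` S by move=> b [].
(* So [w] is injective and its range meets the span of [B] only in 0. The coefficients of [x] are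
   killed by descending rank of [sigma b]: once the higher ones vanish, the coordinate of [w x] at
   [sigma b] is [c b], and it is 0 because [sigma b] is not in [B]. *)
have w_inj x y : in_span B y -> w x = y -> x = 0.
  move=> By wxy; have /in_span_seq[s [c [us sS _ xE]]] := (genS x).1 I.
  suff c0 d b : b \in s -> (\max_(i <- s) rho (sigma i) - rho (sigma b) < d)%N ->
      c b = 0.
    by rewrite xE big_seq big1// => b bs; rewrite (c0 _ b bs (ltnSn _)) scale0r.
  elim: d b => // d IHd b bs bd.
  have Sb := sS _ bs.
  have : k (sigma b) (w x) = 0.
    rewrite wxy; apply: (dual_span0 kP BS) By; first exact: Ssigma.
    by move=> [_ /(_ b Sb)].
  rewrite xE !linear_sum (bigD1_seq b) //= !linearZ /=.
  (* The lower terms of [w b'] have rank below that of [sigma b], so only the leading term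
     [sigma b'] can contribute. *)
  have kw b' : b' \in s -> (rho (sigma b') <= rho (sigma b))%N ->
      k (sigma b) (w b') = (sigma b == sigma b')%:R.
    move=> b's le_b'; have Sb' := sS _ b's.
    rewrite -[w b'](subrK (sigma b')) linearD /=.
    rewrite (kP _ _ (Ssigma _ Sb) (Ssigma _ Sb')).
    rewrite (dual_span0 kP _ _ _ (w_low _ Sb')) ?add0r//.
    - by move=> z [].
    - exact: Ssigma.
    - by move=> [_]; rewrite ltnNge le_b'.
  rewrite kw// eqxx mulr1 big_seq_cond big1 ?addr0//.
  move=> b' /andP[b's b'b]; rewrite !linearZ /=.
  have [le_b'|lt_b] := leqP (rho (sigma b')) (rho (sigma b)).
    rewrite kw//; case: eqP => [/sigma_inj e|_]; last by rewrite mulr0.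
    by move: b'b; rewrite e ?eqxx//; exact: sS.
  rewrite (IHd b') ?mul0r//.
  have bM : (rho (sigma b') <= \max_(i <- s) rho (sigma i))%N.
    by rewrite leq_bigmax_seq.
  move: bd bM lt_b; lia.
exists B; split.
  move=> x; suff: generated B x by [].
  have := (genS x).1 I; apply: in_span_min; first exact: generated_subspace.
  (* Induction on the rank: a basis vector outside [B] is some [sigma b'], that is [w b'] minus
     terms of lower rank, and [b'] itself has lower rank. *)
  move=> {x} b; have [n] := ubnP (rho b); elim: n b => // n IHn b.
  rewrite ltnS => bn Sb; have [Bb|NBb] := pselect (B b); first exact: generated_gen.
  have [b' Sb' eb'] : exists2 b', S b' & sigma b' = b.
    apply: contrapT => Nb'; apply: NBb; split=> // b' Sb' eb'.
    by apply: Nb'; exists b'.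
  have lt_b' := rho_lt _ Sb'; rewrite eb' in lt_b'.
  rewrite -eb' -[sigma b'](subKr (w b')).
  apply: (subspaceB (generated_subspace B)).
    by apply/generated_stable/IHn => //; exact: leq_trans bn.
  apply: in_span_min (w_low _ Sb'); first exact: generated_subspace.
  by rewrite eb' => z [Sz zb]; apply: IHn => //; exact: leq_trans bn.
move=> n b p b_inj Bb.
(* A relation splits into its constant terms, which lie in the span of [B], and [w] applied to a
   shorter sum. By [w_inj] that sum vanishes, then the constant terms do by independence of [S]. *)
have main N (q : 'I_n -> nat -> F) :
    \sum_(i < n) \sum_(j < N) q i j *: iter j w (b i) = 0 ->
    forall i j, (j < N)%N -> q i j = 0.
  elim: N q => // N IHN q.
  under eq_bigr do rewrite big_ord_recl /=.
  rewrite big_split /=.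
  under [X in _ + X]eq_bigr => i _ do under eq_bigr do rewrite -linearZ.
  under [X in _ + X]eq_bigr do rewrite -linear_sum.
  rewrite -linear_sum addrC /= => /eqP; rewrite addr_eq0 => /eqP wE.
  have x0 := w_inj _ _ _ wE.
  have {}x0 : \sum_(i < n) \sum_(j < N) q i j.+1 *: iter j w (b i) = 0.
    apply: x0; rewrite -scaleN1r; apply: subspaceZ; first exact: in_span_subspace.
    apply: subspace_sum; first exact: in_span_subspace.
    by move=> i; apply: subspaceZ; [exact: in_span_subspace|exact: in_span_gen].
  move=> i [_|j jN]; last exact: (IHN (fun i j => q i j.+1)).
  move: wE; rewrite x0 linear0 => /esym/eqP; rewrite oppr_eq0 => /eqP.
  by move=> /(iS n b (fun i => q i 0%N) b_inj); apply => // l; exact: BS.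
move=> sum0 i; apply/polyP => j; rewrite coef0.
pose N := (\max_(i < n) size (p i) + j.+1)%N.
apply: (main N (fun i j => (p i)`_j)); last by rewrite /N; lia.
rewrite -[RHS]sum0; apply: eq_bigr => l _; apply/esym/poly_act_wide.
apply: leq_trans (leq_addr _ _).
exact: (leq_bigmax (F := fun i => size (p i))).
Qed.

End ElementaryCriterion.

(** * Cardinalities of bases and spanning sets *)

Section Dimension.
Variables (F : fieldType) (V : lmodType F).

Lemma lin_indep_notin_span (S : set V) b :
  lin_indep S -> S b -> ~ in_span (S `\ b) b.
Proof.
move=> iS Sb /in_span_seq[s [c [us sS c0 bE]]].
have bs : b \notin s by apply/negP => /sS[_]; apply.
have cb : c =1 (fun x => (x == b)%:R).
  apply: (@lin_indep_uniq_coef _ _ S s [:: b]) => //.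
  - by move=> x /sS[].
  - by move=> x; rewrite /= inE => /eqP->.
  - by move=> x; rewrite inE => /negPf->.
  - by rewrite -bE big_seq1 eqxx scale1r.
by have := cb b; rewrite c0// eqxx => /esym/eqP; rewrite oner_eq0.
Qed.

(* Every element of [S] occurs in the [S]-expansion of some element of [D]. *)
Lemma card_basis_le_span (W S D : set V) :
  is_basis_of W S -> D `<=` W -> (forall x, S x -> in_span D x) ->
  S #<= D `*` [set: nat].
Proof.
move=> [_ [iS genS]] DW SD.
have /choice[t tP] : forall d, exists s : seq V,
    D d -> [set` s] `<=` S /\ in_span [set` s] d.
  move=> d; have [Dd|NDd] := pselect (D d); last by exists [::].
  have /in_span_seq[s [c [_ sS _ dE]]] := (genS d).1 (DW _ Dd).
  by exists s => _; split=> //; rewrite dE; exact: in_span_sum_seq.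
(* If [b] occurred in no expansion, [D] would lie in the span of the other elements of [S], and then
   so would [b]. *)
have /choice[h hP] : forall b, exists d, S b -> D d /\ b \in t d.
  move=> b; have [Sb|NSb] := pselect (S b); last by exists 0.
  apply: contrapT => Nd; apply: (lin_indep_notin_span iS Sb).
  apply: in_span_min (SD _ Sb); first exact: in_span_subspace.
  move=> d Dd; have [tS] := tP _ Dd; apply: in_span_sub => x xt.
  split; first exact: tS.
  by move=> xb; apply: Nd; exists d => _; split; rewrite // -xb.
apply/(inj_card_leP (0, 0%N)); exists (fun b => (h b, index b (t (h b)))).
split=> [b /hP[]//|b b' /hP[_ bt] /hP[_ bt'] [e]].
rewrite e in bt *; by move/(congr1 (nth 0 (t (h b')))); rewrite !nth_index.
Qed.

Lemma in_span_finite (s : seq V) x : in_span [set` s] x ->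
  exists a : 'I_(size s) -> F, x = \sum_(j < size s) a j *: s`_j.
Proof.
pose P x := exists a : 'I_(size s) -> F, x = \sum_(j < size s) a j *: s`_j.
apply: (@in_span_min _ _ _ P).
  split; first by exists (fun=> 0); rewrite big1// => j _; rewrite scale0r.
  move=> c y z [a ->] [a' ->]; exists (fun j => c * a j + a' j).
  rewrite scaler_sumr -big_split; apply: eq_bigr => j _.
  by rewrite scalerDl scalerA.
move=> y /= ys; have ys' : (index y s < size s)%N by rewrite index_mem.
exists (fun j => (j == Ordinal ys')%:R).
rewrite (bigD1 (Ordinal ys')) //= eqxx scale1r nth_index// big1 ?addr0//.
by move=> j /negPf->; rewrite scale0r.
Qed.

(** Expanding more vectors than [D] has elements gives a matrix with more rows than columns; a
    nonzero row in its left kernel is a linear relation. *)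
Lemma finite_lin_indep (S D : set V) : finite_set D -> lin_indep S ->
  (forall x, S x -> in_span D x) -> finite_set S.
Proof.
move=> /finite_seqP[s ->] iS SD; apply: contrapT.
move=> /infiniteP/(inj_card_leP (0 : V))[f [fS finj]].
have /choice[a aP] : forall i, exists a : 'I_(size s) -> F,
    f i = \sum_(j < size s) a j *: s`_j.
  by move=> i; apply/in_span_finite/SD/fS.
pose A : 'M[F]_((size s).+1, size s) := \matrix_(i, j) a i j.
have : kermx A != 0.
  rewrite kermx_eq0 /row_free neq_ltn; apply/orP; left.
  by rewrite ltnS rank_leq_col.
move=> /rowV0Pn[r /sub_kermxP rA]; apply/negP; rewrite negbK; apply/eqP/rowP => i.
rewrite mxE.
apply: (iS _ (fun i : 'I_(size s).+1 => f i) (fun i => r 0 i)).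
- by move=> k l /finj e; apply/val_inj/e.
- by move=> k; exact: fS.
- under eq_bigr do rewrite aP scaler_sumr.
  rewrite exchange_big big1 //= => j _.
  under eq_bigr do rewrite scalerA.
  rewrite -scaler_suml; have /rowP/(_ j) := rA; rewrite !mxE => e.
  rewrite -[RHS](scale0r (s`_j)) -[X in _ = X *: _]e; congr (_ *: _).
  by apply: eq_bigr => k _; rewrite !mxE.
Qed.

Lemma infinite_dim_basis (S : set V) :
  infinite_dim V -> is_basis_of setT S -> infinite_set S.
Proof.
move=> Vinf [_ [_ genS]] /finite_seqP[s sE]; apply: Vinf.
exists (size s), (fun j : 'I_(size s) => s`_j) => x; apply: in_span_finite.
by rewrite -sE; exact/genS.
Qed.

End Dimension.

(** * Maximal sets [Y] jointly free with their image under [u] *)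

Section DoubledFamily.
Variables (F : fieldType) (V : lmodType F) (u : {linear V -> V}).

Definition doubly_free (s : seq V) : Prop := uniq s -> forall c d : V -> F,
  \sum_(y <- s) (c y *: y + d y *: u y) = 0 ->
  forall y, y \in s -> c y = 0 /\ d y = 0.

Variable Y : set V.
Hypothesis Yfree : forall s : seq V, [set` s] `<=` Y -> doubly_free s.

Lemma doubly_free_inj y z : Y y -> Y z -> u y = u z -> y = z.
Proof.
move=> Yy Yz e; apply: contrapT => /eqP yz.
have [||||_] := @Yfree [:: y; z] _ _ (fun=> 0) (fun x => if x == y then 1 else -1) _ y.
- by move=> x /=; rewrite !inE => /orP[]/eqP->.
- by rewrite /= inE yz.
- rewrite big_cons big_seq1 eqxx eq_sym (negPf yz) !scale0r !add0r scale1r e.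
  by rewrite scaleN1r subrr.
- by rewrite inE eqxx.
- by move=> /eqP; rewrite eqxx oner_eq0.
Qed.

Lemma doubly_free_disj y z : Y y -> Y z -> y <> u z.
Proof.
move=> Yy Yz e; have [eyz|yz] := eqVneq y z.
  have [||||/eqP] := @Yfree [:: y] _ _ (fun=> 1) (fun=> -1) _ y.
  - by move=> x /=; rewrite !inE => /eqP->.
  - by [].
  - by rewrite big_seq1 scale1r scaleN1r [in u y]eyz -e subrr.
  - by rewrite inE.
  - by rewrite oner_eq0.
have [||||/eqP] := @Yfree [:: y; z] _ _
    (fun x => if x == y then 1 else 0) (fun x => if x == y then 0 else -1) _ y.
- by move=> x /=; rewrite !inE => /orP[]/eqP->.
- by rewrite /= inE yz.
- rewrite big_cons big_seq1 eqxx eq_sym (negPf yz) !scale0r add0r addr0 scale1r -e.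
  by rewrite scaleN1r subrr.
- by rewrite inE eqxx.
- by rewrite eqxx oner_eq0.
Qed.

(** Any list from this set sits inside some [t ++ map u t] with [t] from [Y], which has no
    repetition by the two previous lemmas; extending the coefficients by 0 gives a relation of the
    doubled form. *)
Lemma doubly_free_lin_indep : lin_indep (Y `|` u @` Y).
Proof.
apply/lin_indep_seqP => s sY us c c0.
have [t [ut tY st]] : exists t : seq V, [/\ uniq t, [set` t] `<=` Y &
    {subset s <= t ++ [seq u y | y <- t]}].
  elim: s sY {us c0} => [|x s IHs] sY; first by exists [::]; split=> // y.
  have [y ys|t [ut tY st]] := IHs; first by apply: sY; rewrite /= inE ys orbT.
  have [y Yy xy] : exists2 y, Y y & x = y \/ x = u y.
    by have [Yx|[y Yy <-]] := sY x (mem_head _ _); [exists x|exists y] => //;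
       [left|right].
  exists (undup (y :: t)); split; first exact: undup_uniq.
    move=> z; rewrite -[X in X -> _]/(is_true (z \in undup (y :: t))).
    by rewrite mem_undup inE => /predU1P[->//|/tY].
  move=> z; rewrite inE mem_cat mem_undup inE => /predU1P[->|/st].
    case: xy => ->; first by rewrite eqxx.
    by rewrite map_f ?orbT// mem_undup mem_head.
  rewrite mem_cat => /orP[->|/mapP[z' z't ->]]; first by rewrite orbT.
  by rewrite map_f ?orbT// mem_undup inE z't orbT.
pose c' b := if b \in s then c b else 0.
have ut2 : uniq (t ++ [seq u y | y <- t]).
  rewrite cat_uniq ut /=; apply/andP; split.
    apply/hasPn => _ /mapP[y yt ->]; apply/negP => /= uyt.
    exact: (doubly_free_disj (tY _ uyt) (tY _ yt)).
  by rewrite map_inj_in_uniq// => y z /tY Yy /tY Yz; exact: doubly_free_inj.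
have := Yfree tY ut (c := c') (d := fun y => c' (u y)).
rewrite big_split /= -(big_map u predT (fun b => c' b *: b)) -big_cat /=.
rewrite (big_subseq_support us ut2 st); last first.
  by move=> b; rewrite /c' => /negPf->; rewrite scale0r.
have -> : \sum_(b <- s) c' b *: b = 0.
  by rewrite -[RHS]c0; apply: eq_big_seq => b; rewrite /c' => ->.
move=> /(_ erefl) c'0 b bs; have -> : c b = c' b by rewrite /c' bs.
by have := st _ bs; rewrite mem_cat => /orP[/c'0[]|/mapP[y /c'0[] ? ? ->]].
Qed.

Hypothesis Ymax : forall x, ~ Y x ->
  exists s : seq V, [set` s] `<=` Y `|` [set x] /\ ~ doubly_free s.

(** As [x] cannot be adjoined to [Y], some nontrivial [c x *: x + d x *: u x] lies in the span.
    Since [x] does not, [d x] is nonzero and can be divided out. *)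
Lemma doubly_free_maximal x : ~ in_span (Y `|` u @` Y) x ->
  exists l, in_span (Y `|` u @` Y) (u x - l *: x).
Proof.
move=> NWx; have sW := in_span_subspace (Y `|` u @` Y).
have NYx : ~ Y x by move=> Yx; apply: NWx; apply: in_span_gen; left.
have [s [sY Ns]] := Ymax NYx.
apply: contrapT => Nl; apply: Ns => us c d c0.
pose s' := [seq y <- s | y != x].
have s'Y : [set` s'] `<=` Y.
  by move=> y; rewrite /= mem_filter => /andP[/eqP yx /sY[]].
have us' : uniq s' by rewrite filter_uniq.
have Ws' : in_span (Y `|` u @` Y) (\sum_(y <- s') (c y *: y + d y *: u y)).
  rewrite big_seq; elim/big_rec: _ => [|y z ys' Wz]; first exact: sW.1.
  apply: subspaceD Wz => //; apply: subspaceD => //; apply: subspaceZ => //.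
    by apply: in_span_gen; left; exact: s'Y.
  by apply: in_span_gen; right; exists y => //; exact: s'Y.
have cdx : x \in s -> c x = 0 /\ d x = 0.
  move=> xs; move: c0; rewrite (bigD1_seq x) //= -big_filter -/s'.
  move=> /eqP; rewrite addr_eq0 => /eqP e.
  have {Ws'}Wx : in_span (Y `|` u @` Y) (c x *: x + d x *: u x).
    by rewrite e -scaleN1r; exact: subspaceZ.
  have dx : d x = 0.
    apply: contrapT => /eqP dx; apply: Nl; exists (- ((d x)^-1 * c x)).
    have -> : u x - - ((d x)^-1 * c x) *: x = (d x)^-1 *: (c x *: x + d x *: u x).
      by rewrite scalerDr !scalerA mulVf// scale1r addrC scaleNr opprK.
    exact: subspaceZ.
  split=> //; apply: contrapT => /eqP cx; apply: NWx.
  have -> : x = (c x)^-1 *: (c x *: x + d x *: u x).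
    by rewrite dx scale0r addr0 scalerA mulVf// scale1r.
  exact: subspaceZ.
have s'0 : \sum_(y <- s') (c y *: y + d y *: u y) = 0.
  rewrite big_filter -[RHS]c0 [RHS](bigID (fun i => i != x)) /=.
  rewrite [X in _ = _ + X]big_seq_cond [X in _ = _ + X]big1 ?addr0// => i.
  rewrite negbK => /andP[is_ /eqP ix]; rewrite ix in is_ *.
  by have [-> ->] := cdx is_; rewrite !scale0r addr0.
move=> y ys; have [yx|yx] := eqVneq y x; first by rewrite yx in ys *; exact: cdx.
by apply: (Yfree s'Y us' s'0); rewrite mem_filter yx.
Qed.

End DoubledFamily.

(** A version modulo [W] of the fact that a map with every nonzero vector an eigenvector is a
    homothety. The first alternative is codimension at most 1; the second covers [z] in [W] too, so
    it makes [W] stable under [u]. *)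
Lemma scalar_mod_subspace (F : fieldType) (V : lmodType F)
    (u : {linear V -> V}) (W : V -> Prop) :
  subspace W -> (forall x, ~ W x -> exists l, W (u x - l *: x)) ->
  (exists x, forall z, exists c, W (z - c *: x)) \/
  (exists l, forall z, W (u z - l *: z)).
Proof.
move=> sW Wl; have [|N1] := pselect (exists x, forall z, exists c, W (z - c *: x)).
  by left.
right; have {}N1 x : exists z, forall c, ~ W (z - c *: x).
  apply: contrapT => Nz; apply: N1; exists x => z; apply: contrapT => Nc.
  by apply: Nz; exists z => c Wc; apply: Nc; exists c.
have [x xP] := N1 0; have {xP}NWx : ~ W x by have := xP 0; rewrite scaler0 subr0.
have [l Wx] := Wl _ NWx; exists l.
have sub2 (p q r : V) : (p - q) - (p - r) = r - q.
  by rewrite opprB addrC addrA subrK.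
(* Comparing the scalars of [x], [z] and [x + z] gives a relation between [z] and [x] modulo [W],
   which forces them to agree. *)
have indep z : (forall c, ~ W (z - c *: x)) -> W (u z - l *: z).
  move=> Nz; have NWz : ~ W z by have := Nz 0; rewrite scale0r subr0.
  have NWxz : ~ W (x + z) by have := Nz (-1); rewrite scaleN1r opprK addrC.
  have [m Wz] := Wl _ NWz; have [n Wxz] := Wl _ NWxz.
  have Wc : W ((m - n) *: z - (n - l) *: x).
    have := subspaceB sW (subspaceB sW Wxz Wx) Wz.
    congr W; rewrite linearD /= scalerDr !scalerBl opprD addrACA.
    by rewrite -[LHS]addrA addrACA !sub2 opprB addrC.
  have [mn|mn] := eqVneq m n.
    have [nl|nl] := eqVneq n l; first by rewrite -nl -mn.
    case: NWx; have := subspaceZ (- (n - l)^-1) sW Wc.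
    rewrite mn subrr scale0r add0r scalerN scaleNr opprK scalerA mulVf ?scale1r//.
    by rewrite subr_eq0.
  case: (Nz ((m - n)^-1 * (n - l))).
  have := subspaceZ (m - n)^-1 sW Wc.
  by rewrite scalerBr !scalerA mulVf ?scale1r// subr_eq0.
move=> z; have [Nz|/existsNP[c /contrapT Wc]] :=
  pselect (forall c, ~ W (z - c *: x)); first exact: indep.
(* A vector dependent on [x] modulo [W] is the difference of [z + z0] and [z0], both independent of
   [x]. *)
have [z0 Nz0] := N1 x.
have Nzz0 c' : ~ W (z + z0 - c' *: x).
  move=> Wc'; apply: (Nz0 (c' - c)); have := subspaceB sW Wc' Wc.
  congr W; rewrite scalerBl -[z + z0 - _]addrA -[z0 - c' *: x]opprK sub2 opprK.
  by rewrite opprB addrCA.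
have := subspaceB sW (indep _ Nzz0) (indep _ Nz0).
by congr W; rewrite linearD /= scalerDr opprD addrACA addrK.
Qed.

(** Each element is recorded by some [y] in [Y] and a tag 0, 1 or 2, according to whether it is [y],
    [u y] or [x]. *)
Lemma card_le_doubled (F : fieldType) (V : lmodType F) (u : V -> V)
    (Y : set V) (x : V) : infinite_set Y ->
  (Y `|` u @` Y) `|` [set x] #<= Y `*` [set: nat].
Proof.
move=> Yinf; have [y0 Yy0] := infinite_setN0 Yinf.
have /choice[h hP] : forall z, exists p : V * nat,
    ((Y `|` u @` Y) `|` [set x]) z -> Y p.1 /\
      [\/ p.2 = 0%N /\ z = p.1, p.2 = 1%N /\ z = u p.1 | p.2 = 2%N /\ z = x].
  move=> z; have [[[Yz|[y Yy yz]]|zx]|] :=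
    pselect (((Y `|` u @` Y) `|` [set x]) z); last by exists (y0, 0%N).
  - by exists (z, 0%N) => _; split=> //; constructor 1.
  - by exists (y, 1%N) => _; split=> //; constructor 2.
  - by exists (y0, 2%N) => _; split=> //; constructor 3.
apply/(inj_card_leP (y0, 0%N)); exists h; split=> [z /hP[]//|z z' /hP[_ zE] /hP[_ zE'] e].
by move: zE zE'; rewrite e => -[] [-> ->] [] [] // _ ->.
Qed.

(** * Construction of the doubled family and of the decomposition *)

Section Assembly.
Variables (F : fieldType) (V : lmodType F) (u : {linear V -> V}).

Lemma exists_doubled_family :
  infinite_dim V -> (forall l : F, ~ dominant_eigenvalue u l) ->
  exists Y S : set V, [/\ is_basis_of setT S, Y `|` u @` Y `<=` S,
    (forall y z, Y y -> Y z -> u y = u z -> y = z),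
    (forall y z, Y y -> Y z -> y <> u z) & S `*` [set: nat] #<= Y].
Proof.
move=> Vinf Ndom.
have [|Y [_ _ Yfree Ymax0]] :=
    @finitary_maximal _ (doubly_free u) set0 setT (@sub0set _ _).
  by move=> [//|x s] /(_ x (mem_head _ _)).
have Ymax x := Ymax0 x I.
have sT : subspace [set: V] by [].
have iD := doubly_free_lin_indep Yfree.
set D := Y `|` u @` Y in iD *.
have [S [DS bS]] := lin_indep_extend sT (@subsetT _ D) iD.
have Sinf := infinite_dim_basis Vinf bS.
exists Y, S; split=> //; [exact: doubly_free_inj|exact: doubly_free_disj|].
have Dfin : finite_set Y -> finite_set D.
  by move=> Yfin; rewrite finite_setU; split=> //; exact: finite_image.
suff [x [Yinf SD]] : exists x, infinite_set Y /\ S #<= D `|` [set x].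
  apply: card_le_trans (card_le_mul_nat Yinf).
  apply: card_le_trans (card_le_mul_nat Sinf) _.
  exact: card_le_trans SD (card_le_doubled _ _ Yinf).
have sW := in_span_subspace D.
have [[x xP]|[l lP]] := scalar_mod_subspace sW (doubly_free_maximal Yfree Ymax).
  exists x.
  have SDx z : in_span (D `|` [set x]) z.
    have [c Wc] := xP z; rewrite -[z](subrK (c *: x)).
    apply: subspaceD (in_span_subspace _) _ _.
      by apply: in_span_sub Wc; left.
    by apply: subspaceZ; [exact: in_span_subspace|apply: in_span_gen; right].
  have Yinf : infinite_set Y.
    move=> /Dfin Dfin'; apply: Sinf.
    apply: (finite_lin_indep (D := D `|` [set x])) => //; last by case: bS => _ [].
    by rewrite finite_setU.
  split=> //; apply: card_le_trans (card_le_mul_nat _).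
    exact: (card_basis_le_span bS).
  by apply: sub_infinite_set Yinf => y Yy; left; left.
(* In the scalar case [D] alone is large enough; 0 only fills the place of [x]. *)
exists 0.
pose R := range (fun x => u x - l *: x).
have sR : subspace R.
  split; first by exists 0 => //; rewrite linear0 scaler0 subrr.
  move=> a _ _ [x _ <-] [y _ <-]; exists (a *: x + y) => //.
  rewrite linearP scalerDr scalerBr !scalerA [l * a]mulrC opprD addrACA.
  by [].
have i0 : lin_indep (set0 : set V).
  by apply/lin_indep_seqP => -[|x s] // /(_ x (mem_head _ _)).
have [B [_ bB]] := lin_indep_extend sR (@sub0set _ _) i0.
have [C [BC bC]] := lin_indep_extend sT (@subsetT _ B) bB.2.1.
(* Otherwise the rank of [u - l] would be less than the dimension, making [l] dominant. *)
have CB : C #<= B.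
  apply: contrapT => NCB; apply: (Ndom l); exists B, C; split=> //; split=> //.
  by split=> //; exact: subset_card_le.
have BW x : B x -> in_span D x.
  by move=> /bB.1[y _ <-]; exact: lP.
have [B' [BB' bB']] := lin_indep_extend sW BW bB.2.1.
have Cinf := infinite_dim_basis Vinf bC.
have Yinf : infinite_set Y.
  move=> /Dfin Dfin'; apply: Cinf; apply: card_le_finite CB _.
  exact: (finite_lin_indep Dfin' bB.2.1).
have Dinf : infinite_set D by apply: sub_infinite_set Yinf => y Yy; left.
split=> //.
(* [B] lies in the span of [D], hence in a basis [B'] of that span, which is compared with [D] by
   expansions. *)
have CD : C #<= D `*` [set: nat].
  apply: card_le_trans CB _; apply: card_le_trans (subset_card_le BB') _.
  apply: (card_basis_le_span bB'); first by move=> d; exact: in_span_gen.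
  exact: bB'.1.
apply: card_le_trans (subset_card_le (@subsetUl _ D [set 0])).
apply: card_le_trans (card_le_mul_nat_trans Dinf CD).
(* The bases [S] and [C] are compared only up to a factor [nat], absorbed by the infinite set
   [D]. *)
by apply: (card_basis_le_span bS) => // x _; exact/bC.2.2.
Qed.

Lemma decomposition_of_doubled_family (a : F) (Y S : set V) :
  is_basis_of setT S -> Y `|` u @` Y `<=` S ->
  (forall y z, Y y -> Y z -> u y = u z -> y = z) ->
  (forall y z, Y y -> Y z -> y <> u z) -> S `*` [set: nat] #<= Y ->
  exists v : {linear V -> V},
    (forall x : V, v (v x) = a *: v x) /\ elementary (fun x => u x - v x).
Proof.
move=> bS DS u_inj u_disj /(inj_card_leP (0 : V))[g [gY g_inj]].
have YS y : Y y -> S y by move=> Yy; apply: DS; left.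
have uYS y : Y y -> S (u y) by move=> Yy; apply: DS; right; exists y.
have {}gY b n : S b -> Y (g (b, n)) by move=> Sb; exact: (gY (b, n)).
have {}g_inj b n b' n' : S b -> S b' -> g (b, n) = g (b', n') -> b = b' /\ n = n'.
  move=> Sb Sb' e.
  by have [-> ->] := g_inj (b, n) (b', n') (conj Sb I) (conj Sb' I) e.
have /choice[rho0 rho0P] : forall x, exists m, forall b n, S b -> x = g (b, n) -> m = n.
  move=> x; have [[b [n [Sb ->]]]|N] := pselect (exists b n, S b /\ x = g (b, n)).
    by exists n => b' n' Sb' /g_inj[].
  by exists 0%N => b n Sb xE; case: N; exists b, n.
(* The two requirements are consistent because [u] is injective on [Y] and [Y] is disjoint from its
   image. *)
have /choice[rho rhoP] : forall x, exists m, (Y x -> m = rho0 x) /\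
    (forall y, Y y -> x = u y -> m = (rho0 y).+1).
  move=> x; have [[y [Yy ->]]|N] := pselect (exists y, Y y /\ x = u y).
    exists (rho0 y).+1; split=> [Yuy|z Yz /u_inj-> //].
    by case: (u_disj _ _ Yuy Yy).
  by exists (rho0 x); split=> // y Yy xE; case: N; exists y.
have rhog b n : S b -> rho (g (b, n)) = n.
  by move=> Sb; rewrite (rhoP _).1 ?(rho0P _ b n)//; exact: gY.
have rhou y : Y y -> rho (u y) = (rho y).+1.
  by move=> Yy; rewrite ((rhoP (u y)).2 y)// (rhoP y).1.
pose low n := [set b' | S b' /\ (rho b' < n)%N].
have low_sub m n x : (m <= n)%N -> in_span (low m) x -> in_span (low n) x.
  by move=> mn; apply: in_span_sub => b [Sb bm]; split=> //; exact: leq_trans mn.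
(* A vector involves only finitely many basis vectors, so their ranks are bounded. *)
have span_low x : exists n, in_span (low n) x.
  pose P x := exists n, in_span (low n) x.
  have := (bS.2.2 x).1 I; apply: (@in_span_min _ _ _ P) => {x}.
    split; first by exists 0%N; exact: (in_span_subspace _).1.
    move=> c x y [m mx] [n ny]; exists (maxn m n).
    apply: (in_span_subspace _).2; first exact: low_sub (leq_maxl _ _) mx.
    exact: low_sub (leq_maxr _ _) ny.
  by move=> b Sb; exists (rho b).+1; apply: in_span_gen.
have /choice[N NP] : forall b, exists n, (rho b < n)%N /\ in_span (low n) (u b).
  move=> b; have [n nP] := span_low (u b); exists (maxn (rho b).+1 n).
  by split; [exact: leq_maxl|exact: low_sub (leq_maxr _ _) nP].
pose r b := g (b, N b).
have rY b : S b -> Y (r b) by move=> Sb; exact: gY.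
have [v vE] := @linear_extension _ _ V S
  (fun b => if `[< Y b >] then a *: b else - r b) bS.
have vY b : Y b -> v b = a *: b.
  by move=> Yb; rewrite vE ?asboolT//; exact: YS.
have vNY b : S b -> ~ Y b -> v b = - r b by move=> Sb NYb; rewrite vE ?asboolF.
exists v; split=> [x|].
  (* [v] maps [S] into the span of [Y], on which it is multiplication by [a]. *)
  pose P x := v (v x) = a *: v x.
  have := (bS.2.2 x).1 I; apply: (@in_span_min _ _ _ P) => [|b Sb].
    split; first by rewrite /P !linear0.
    move=> c y z; rewrite /P => ey ez; rewrite linearP [LHS]linearP ey ez.
    by rewrite scalerDr !scalerA mulrC.
  have [Yb|NYb] := pselect (Y b); first by rewrite /P (vY _ Yb) linearZ /= vY.
  by rewrite /P (vNY _ Sb NYb) linearN (vY _ (rY _ Sb)) scalerN.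
pose sigma b := if `[< Y b >] then u b else r b.
have sY b : Y b -> sigma b = u b by move=> Yb; rewrite /sigma asboolT.
have sNY b : ~ Y b -> sigma b = r b by move=> NYb; rewrite /sigma asboolF.
have rho_lt b : S b -> (rho b < rho (sigma b))%N.
  move=> Sb; have [Yb|NYb] := pselect (Y b); first by rewrite sY// rhou.
  by rewrite sNY// rhog//; case: (NP b).
apply: (@elementary_of_shift _ _ (u \- v) S sigma rho) => //.
- move=> b Sb; have [Yb|NYb] := pselect (Y b); first by rewrite sY//; exact: uYS.
  by rewrite sNY//; apply/YS/rY.
- move=> b b' Sb Sb'.
  have [Yb|NYb] := pselect (Y b); have [Yb'|NYb'] := pselect (Y b').
  + by rewrite !sY//; exact: u_inj.
  + by rewrite sY// sNY// => e; case: (u_disj _ _ (rY _ Sb') Yb).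
  + by rewrite sNY// sY// => e; case: (u_disj _ _ (rY _ Sb) Yb').
  + by rewrite !sNY// => /g_inj[].
(* The remainder is [- a *: b] on [Y], of rank one below [u b]; off [Y] it is [u b], whose terms
   have rank below [N b], the rank of [r b]. *)
- move=> b Sb /=; have [Yb|NYb] := pselect (Y b).
    rewrite sY// vY// addrAC subrr add0r -scaleNr.
    apply: subspaceZ; first exact: in_span_subspace.
    by apply: in_span_gen; split=> //; rewrite rhou.
  rewrite sNY// vNY// opprK addrK rhog//.
  exact: (NP b).2.
Qed.

End Assembly.

Theorem theorem9 (F : fieldType) (V : lmodType F) (u : {linear V -> V}) :
  infinite_dim V ->
  (forall lambda : F, ~ dominant_eigenvalue u lambda) ->
  forall a : F, exists v : {linear V -> V},
    (forall x : V, v (v x) = a *: v x) /\ elementary (fun x => u x - v x).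
Proof.
move=> Vinf Ndom a.
have [Y [S [bS DS u_inj u_disj SY]]] := exists_doubled_family Vinf Ndom.
exact: decomposition_of_doubled_family bS DS u_inj u_disj SY.
Qed.
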